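(* Let $D$ be a quasi-local GMPD domain. Then $\mathcal{O}(D)=\mathcal{O}_{ql}(D)$, that is, every overring of $D$ is quasi-local.
   Context: All rings are commutative unitary integral domains. A ring is quasi-local if it has exactly one maximal ideal (no Noetherian assumption). For an integral domain $D$ with quotient field $K$, an overring of $D$ is a subring of $K$ containing $D$; $\mathcal{O}(D)$ is the set of all overrings of $D$ and $\mathcal{O}_{ql}(D)$ is the set of those overrings of $D$ which are quasi-local. $D$ is h-local if each nonzero ideal of $D$ is contained in only finitely many maximal ideals and each nonzero prime ideal is contained in a unique maximal ideal. An MNI ideal of $D$ is an ideal of $D$ which is maximal (under inclusion) among the non-invertible ideals of $D$ (the zero ideal counts as non-invertible). $D$ is an MPD domain if it has a unique MNI ideal $Q$ and every nonzero non-invertible ideal of $D$ can be written as $JQ$ for some invertible ideal $J$ of $D$. $D$ is a GMPD domain (globalized multiplicatively pinched-Dedekind domain) if $D$ is h-local and the localization $D_M$ is an MPD domain for every maximal ideal $M$ of $D$. *)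

(* Defs.v *)
From mathcomp Require Import all_boot all_order all_algebra.
From mathcomp Require Import boolp classical_sets functions cardinality.

Set Implicit Arguments.
Unset Strict Implicit.
Unset Printing Implicit Defensive.

Import GRing.Theory.

Local Open Scope classical_set_scope.
Local Open Scope ring_scope.

(* A domain D, its overrings and its
   localizations are all represented as subrings of one ambient field K, the
   quotient field of D. *)

Section IdealTheory.
Variable K : fieldType.
Implicit Types D R A I J P M Q : set K.

Definition subring R : Prop := subring_closed [in R].

Definition quotient_field_of R : Prop :=
  forall x : K, exists a b, [/\ R a, R b, b != 0 & x = a / b].

(* Unlike [idealr_closed], this does not require the ideal to be proper. *)
Definition ideal R I : Prop :=
  [/\ I `<=` R, I 0, (forall x y, I x -> I y -> I (x + y))
    & (forall a x, R a -> I x -> I (a * x))].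

Definition nonzero I : Prop := I <> [set 0].

Definition maximal_ideal R M : Prop :=
  [/\ ideal R M, M <> R
    & forall J, ideal R J -> J <> R -> M `<=` J -> J = M].

Definition prime_ideal R P : Prop :=
  [/\ ideal R P, P <> R
    & forall x y, R x -> R y -> P (x * y) -> P x \/ P y].

Definition quasi_local R : Prop := exists! M, maximal_ideal R M.

Definition idealM I J : set K :=
  [set z | exists (n : nat) (x y : 'I_n -> K),
     (forall i, I (x i) /\ J (y i)) /\ z = \sum_(i < n) x i * y i].

Definition frac_inv R I : set K := [set x | forall y, I y -> R (x * y)].

(* The inverse is taken inside K, so this is the usual notion of an invertible
   ideal when K is the quotient field of R. *)
Definition invertible R I : Prop := idealM I (frac_inv R I) = R.

Definition MNI_ideal R Q : Prop :=
  [/\ ideal R Q, ~ invertible R Q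
    & forall J, ideal R J -> ~ invertible R J -> Q `<=` J -> J = Q].

(* J has to be an ideal of R here, not merely a fractional one. *)
Definition MPD_domain R : Prop :=
  exists2 Q, unique (MNI_ideal R) Q &
    forall I, ideal R I -> nonzero I -> ~ invertible R I ->
      exists J, [/\ ideal R J, invertible R J & I = idealM J Q].

Definition h_local R : Prop :=
  (forall I, ideal R I -> nonzero I ->
     finite_set [set M | maximal_ideal R M /\ I `<=` M]) /\
  (forall P, prime_ideal R P -> nonzero P ->
     exists! M, maximal_ideal R M /\ P `<=` M).

Definition localization R M : set K :=
  [set z | exists a s, [/\ R a, R s, ~ M s & z = a / s]].

Definition GMPD_domain R : Prop :=
  h_local R /\ forall M, maximal_ideal R M -> MPD_domain (localization R M).

(* These are all the overrings of D when K is the quotient field of D. *)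
Definition overrings D : set (set K) := [set A | subring A /\ D `<=` A].

Definition ql_overrings D : set (set K) :=
  [set A | overrings D A /\ quasi_local A].

End IdealTheory.

(* Main.v *)
Require Import Defs.
From mathcomp Require Import all_boot all_order all_algebra.
From mathcomp Require Import boolp classical_sets functions cardinality.
From mathcomp Require Import ring.

(** The maximal ideal [M] of the quasi-local domain [D] contains every non-unit,
    so [D] is its own localization at [M] and is an MPD domain. Invertible ideals
    of a quasi-local domain are principal, so every ideal of [D] is [g D] or
    [d Q] with [g] and [d] in [D], where [Q] is the MNI ideal. Up to
    scaling by [K], nonprincipal fractional ideals therefore form a single class,
    and within [D] the scaling factor can even be taken in [D].

    Quasi-locality of an overring [A] means that [x] or [1 - x] is a unit of [A]
    for every [x] in [A]. Put [I = D + D x]. If [I] or [I^2] is principal, one of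
    its generators [1], [x], [x^2] generates it, which forces [x] or [1 / x] into
    [D]. Otherwise [I^2 = c I] for some [c], because there is only one
    nonprincipal class. Then [T = I / c] is idempotent and finitely generated,
    so the determinant trick ([span2_fixed]) shows that it is a ring; moreover
    [T] lies in [I], hence in [A].

    The ring [T] is in the class of [Q], so it acts on [Q]. For a nonzero [e]
    in [T], the ideal [e Q] of [D] is again nonprincipal, so it is [d Q] with [d]
    in [D], and [e] is [d] times a unit of [T] ([element_associate]). Two
    non-units of [T] thus lie in [M T], which does not contain [1] by Nakayama's
    lemma: [T] is quasi-local ([nonprincipal_overring_local]). It remains to carry
    this back to [x], a quotient of the two generators [1 / c] and [x / c] of [T]
    ([overring_unit_or]). The factor [d] has to be in [D]: for the local ring
    of a node, all nonprincipal fractional ideals are proportional too, but the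
    integral closure is an overring with two maximal ideals. *)

Set Implicit Arguments.
Unset Strict Implicit.
Unset Printing Implicit Defensive.

Import GRing.Theory.

Local Open Scope classical_set_scope.
Local Open Scope ring_scope.

(** * Subrings of a field and unit elements *)

Section Subrings.
Variable K : fieldType.
Implicit Types R D A I J M N Q T : set K.

Definition unit_in R (x : K) : Prop := x != 0 /\ R x^-1.

Definition scale (a : K) I : set K := [set a * y | y in I].

Definition principal R I : Prop := exists g, I = scale g R.

Definition span2 N (u v : K) : set K :=
  [set z | exists a b, [/\ N a, N b & z = a * u + b * v]].

Section Closure.
Variable R : set K.
Hypothesis Rring : subring R.

Lemma subring1 : R 1.
Proof. by case: Rring => h _ _; move: h; rewrite inE. Qed.

Lemma subringB x y : R x -> R y -> R (x - y).
Proof. by case: Rring => _ h _ /mem_set Rx /mem_set Ry; apply/set_mem/h. Qed.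

Lemma subringM x y : R x -> R y -> R (x * y).
Proof. by case: Rring => _ _ h /mem_set Rx /mem_set Ry; apply/set_mem/h. Qed.

Lemma subring0 : R 0.
Proof. by rewrite -(subrr 1); apply: subringB; apply: subring1. Qed.

Lemma subringN x : R x -> R (- x).
Proof. by move=> Rx; rewrite -sub0r; apply: subringB => //; apply: subring0. Qed.

Lemma subringD x y : R x -> R y -> R (x + y).
Proof. by move=> Rx Ry; rewrite -[y]opprK; apply/subringB/subringN. Qed.

Lemma unit_in_factor x y : R y -> unit_in R (x * y) -> unit_in R x.
Proof.
move=> Ry [xy0 Rxy]; move: (xy0); rewrite mulf_eq0 negb_or => /andP[x0 y0].
split=> //; have -> : x^-1 = y * (x * y)^-1 by rewrite invfM mulrCA divff ?mulr1.
exact: subringM.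
Qed.

Lemma proper_ideal_nonunit I x : ideal R I -> I <> R -> I x -> ~ unit_in R x.
Proof.
move=> [IR _ _ IM] neq Ix [x0 Rx]; apply: neq; apply/seteqP; split=> // y Ry.
have -> : y = y * x^-1 * x by rewrite mulfVK.
by apply: IM Ix; apply: subringM.
Qed.

Lemma principal_ideal x : R x -> ideal R (scale x R).
Proof.
move=> Rx; split.
- by move=> _ [r Rr <-]; apply: subringM.
- by exists 0; [apply: subring0 | rewrite mulr0].
- move=> _ _ [r Rr <-] [s Rs <-]; exists (r + s); last by rewrite mulrDr.
  exact: subringD.
- move=> a _ Ra [r Rr <-]; exists (a * r); last by rewrite mulrCA.
  exact: subringM.
Qed.

(** The non-units are closed under addition exactly because a sum that is a
    unit can be normalised to [x + (1 - x)]; they then absorb every proper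
    ideal, which gives existence and uniqueness of the maximal ideal at once. *)
Lemma quasi_local_unit_or :
  (forall x, R x -> unit_in R x \/ unit_in R (1 - x)) -> quasi_local R.
Proof.
move=> loc; pose N := [set x | R x /\ ~ unit_in R x].
have N1 : N <> R.
  move=> eqN; have : N 1 by rewrite eqN; apply: subring1.
  by move=> [_]; apply; split; rewrite ?oner_neq0 ?invr1 //; apply: subring1.
have Nid : ideal R N.
  split.
  - by move=> x [].
  - by split; [apply: subring0 | move=> []; rewrite eqxx].
  - move=> x y [Rx nx] [Ry ny]; split; first exact: subringD.
    move=> [s0 Rs].
    have Rxs : R (x * (x + y)^-1) by apply: subringM.
    case: (loc _ Rxs) => [/(unit_in_factor Rs) //|].
    have -> : 1 - x / (x + y) = y / (x + y).
      by rewrite -[1](divff s0) -mulrBl addrAC subrr add0r.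
    by move/(unit_in_factor Rs).
  - move=> a x Ra [Rx nx]; split; first exact: subringM.
    by rewrite mulrC => /(unit_in_factor Ra).
have subN J : ideal R J -> J <> R -> J `<=` N.
  move=> Jid nJ x Jx; split; first by case: Jid => + _ _ _; apply.
  exact: proper_ideal_nonunit nJ Jx.
exists N; split.
  by split=> // J Jid nJ NJ; apply/seteqP; split=> //; apply: subN.
by move=> J [Jid nJ maxJ]; rewrite (maxJ N) //; apply: subN.
Qed.

(** Krull's theorem. The empty set is admitted among the ideals to which Zorn's
    lemma is applied so that the empty chain has an upper bound. *)
Lemma nonunit_in_maximal_ideal s :
  R s -> ~ unit_in R s -> exists2 M, maximal_ideal R M & M s.
Proof.
move=> Rs ns; pose P J := J = set0 \/ [/\ ideal R J, J s & ~ J 1].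
have [F FP Ftot|M [PM maxM]] := @Zorn_bigcup K P.
  case: (EM (exists2 X, F X & X <> set0)) => [[X0 FX0 nX0]|none]; last first.
    left; apply/seteqP; split=> // x [X FX Xx]; apply: none; exists X => //.
    by move=> XE; rewrite XE in Xx.
  have FE X x : F X -> X x -> [/\ ideal R X, X s & ~ X 1].
    by move=> FX Xx; case: (FP _ FX) => [XE|//]; rewrite XE in Xx.
  have [z X0z] : exists z, X0 z by apply/set0P/eqP.
  have [X0id X0s X01] := FE _ _ FX0 X0z.
  right; split; last 2 first.
  - by exists X0.
  - by move=> [X FX X1]; have [_ _] := FE _ _ FX X1; apply.
  split.
  - by move=> x [X FX Xx]; have [[+ _ _ _] _ _] := FE _ _ FX Xx; apply.
  - by exists X0 => //; case: X0id.
  - move=> x y [X FX Xx] [Y FY Yy].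
    have [[_ _ XD _] _ _] := FE _ _ FX Xx.
    have [[_ _ YD _] _ _] := FE _ _ FY Yy.
    case: (Ftot _ _ FX FY) => sub.
      by exists Y => //; apply: YD => //; apply: sub.
    by exists X => //; apply: XD => //; apply: sub.
  - move=> a x Ra [X FX Xx]; exists X => //.
    by have [[_ _ _ XM] _ _] := FE _ _ FX Xx; apply: XM.
have Psub J : P J -> M `<=` J -> J = M.
  move=> PJ MJ; apply: contrapT => neq; apply: (maxM J) => //; split=> // JM.
  by apply: neq; apply/seteqP.
have ss : scale s R s by exists 1; [apply: subring1 | rewrite mulr1].
have Psc : P (scale s R).
  right; split=> //; first exact: principal_ideal.
  move=> [r Rr sr1]; apply: ns; have s0 : s != 0.
    by apply: contra_eq_neq sr1 => ->; rewrite mul0r eq_sym oner_neq0.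
  by split=> //; rewrite -[s^-1]mulr1 -sr1 mulKf.
case: PM => [M0|[Mid Ms M1]].
  by have := Psub _ Psc; rewrite M0 => /(_ (@sub0set _ _)) E; rewrite E in ss.
exists M => //; split=> //.
- by move=> MR; apply: M1; rewrite MR; apply: subring1.
- move=> J Jid nJ MJ; apply: Psub => //; right; split=> //; first exact: MJ.
  move=> J1; apply: (proper_ideal_nonunit Jid nJ J1).
  by split; rewrite ?oner_neq0 ?invr1 //; apply: subring1.
Qed.

End Closure.

(** The determinant trick for two generators. With [u = a u + b v] and
    [v = c u + d v], the determinant [(1 - a) (1 - d) - b c] kills [u] and [v],
    which are not both zero, so it vanishes; expanding it writes [1] as a polynomial without constant term in
    elements of [N]. Taking [N] to be a proper ideal gives Nakayama's lemma,
    and taking [N] to be the module itself shows that a nonzero finitely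
    generated idempotent module contains [1]. *)
Lemma span2_fixed N u v :
    (forall x y, N x -> N y -> N (x + y)) -> (forall x, N x -> N (- x)) ->
    (forall x y, N x -> N y -> N (x * y)) ->
  (u != 0) || (v != 0) -> span2 N u v u -> span2 N u v v -> N 1.
Proof.
move=> ND NN NM uv0 [a [b [Na Nb uE]]] [c [d [Nc Nd vE]]].
have e1 : (1 - a) * u = b * v by rewrite mulrBl mul1r {1}uE; ring.
have e2 : (1 - d) * v = c * u by rewrite mulrBl mul1r {1}vE; ring.
have det0 : (1 - a) * (1 - d) = b * c.
  case/orP: uv0 => w0; apply: (mulIf w0).
    by rewrite -[_ * c * _]mulrA -e2 [RHS]mulrCA -e1; ring.
  by rewrite -[LHS]mulrA e2 mulrCA e1; ring.
have oneE : 1 = a + d + - (a * d) + b * c by rewrite -det0; ring.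
rewrite oneE.
apply: (ND _ _ _ (NM _ _ Nb Nc)).
by apply: (ND _ _ _ (NN _ (NM _ _ Na Nd))); exact: ND.
Qed.

(** * Ideals of a quasi-local domain *)

Section QuasiLocal.
Variables D M : set K.
Hypothesis Dring : subring D.
Hypothesis Mid : ideal D M.
Hypothesis M1 : ~ M 1.
Hypothesis Munit : forall s, D s -> ~ M s -> unit_in D s.

Let D1 := subring1 Dring.
Let D0 := subring0 Dring.
Let DD := subringD Dring.
Let DN := subringN Dring.
Let DM := subringM Dring.

Let MD x : M x -> D x.
Proof. by case: Mid => + _ _ _; apply. Qed.

Let M_add x y : M x -> M y -> M (x + y).
Proof. by case: Mid => _ _ + _; apply. Qed.

Let M_mul a x : D a -> M x -> M (a * x).
Proof. by case: Mid => _ _ _; apply. Qed.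

Let M_opp x : M x -> M (- x).
Proof. by move=> Mx; rewrite -mulN1r; apply: M_mul => //; apply: DN. Qed.

Lemma local_localization : localization D M = D.
Proof.
apply/seteqP; split=> x.
  move=> [a [s [Da Ds nMs ->]]]; apply: DM => //.
  by have [] := Munit Ds nMs.
by move=> Dx; exists x, 1; split=> //; rewrite divr1.
Qed.

Lemma sum_notin_maximal n (f : 'I_n -> K) :
  ~ M (\sum_(i < n) f i) -> exists i, ~ M (f i).
Proof.
move=> nM; apply: contrapT => none; apply: nM.
elim/big_ind: _ => [||i _]; first by case: Mid.
  exact: M_add.
by apply: contrapT => nMi; apply: none; exists i.
Qed.

(** If [1] is a sum of products [x i * y i], one product is a unit, and its
    factor [x i] generates the ideal. *)
Lemma local_invertible_principal J :
  ideal D J -> invertible D J -> exists2 g, D g & J = scale g D.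
Proof.
move=> [JD J0 _ JM] Jinv.
have : idealM J (frac_inv D J) 1 by rewrite Jinv.
move=> [n [x [y [xy s1]]]].
have [i nMi] : exists i, ~ M (x i * y i).
  by apply: sum_notin_maximal; rewrite -s1.
have [Jx yinv] := xy i.
have Dxy : D (x i * y i) by rewrite mulrC; apply: yinv.
have [u0 Du] := Munit Dxy nMi.
exists (x i); first exact: JD.
apply/seteqP; split=> z.
  move=> Jz; exists ((x i * y i)^-1 * (y i * z)); first exact/DM/yinv.
  by rewrite mulrCA [X in _ * X]mulrA mulKf.
by move=> [d Dd <-]; rewrite mulrC; apply: JM.
Qed.

Lemma idealM_principal g I : ideal D I -> idealM (scale g D) I = scale g I.
Proof.
move=> [ID I0 IDD IM]; apply/seteqP; split=> z.
  move=> [n [x [y [xy ->]]]].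
  elim/big_ind: _ => [|_ _ [p Ip <-] [q Iq <-]|i _].
  - by exists 0; rewrite ?mulr0.
  - by exists (p + q); [apply: IDD | rewrite mulrDr].
  - case: (xy i) => [[d Dd <-] Iy]; exists (d * y i); first exact: IM.
    by rewrite mulrA.
move=> [y Iy <-]; exists 1%N, (fun=> g), (fun=> y); split.
  by move=> _; split=> //; exists 1; rewrite ?mulr1.
by rewrite big_ord1.
Qed.

Lemma principal_or_scale_MNI Q :
    ideal D Q ->
    (forall I, ideal D I -> nonzero I -> ~ invertible D I ->
      exists J, [/\ ideal D J, invertible D J & I = idealM J Q]) ->
  forall I, ideal D I ->
    principal D I \/ exists2 d, D d & I = scale d Q.
Proof.
move=> Qid mpd I Iid.
have [I0|In0] := EM (I = [set 0]).
  left; exists 0; rewrite I0; apply/seteqP; split=> z.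
    by move=> ->; exists 0; rewrite ?mul0r.
  by move=> [d _ <-]; rewrite mul0r.
have [Iinv|Ininv] := EM (invertible D I).
  by left; have [g _ ->] := local_invertible_principal Iid Iinv; exists g.
right; have [J [Jid Jinv ->]] := mpd _ Iid In0 Ininv.
have [g Dg ->] := local_invertible_principal Jid Jinv.
by exists g => //; apply: idealM_principal.
Qed.

(** * Domains whose ideals form two classes *)

Section TwoClasses.
Variable Q : set K.
Hypothesis Qid : ideal D Q.
Hypothesis two_classes : forall I, ideal D I ->
  principal D I \/ exists2 d, D d & I = scale d Q.

Lemma scale_scale a b I : scale a (scale b I) = scale (a * b) I.
Proof.
apply/seteqP; split=> z.
  by move=> [_ [y Iy <-] <-]; exists y; rewrite ?mulrA.
by move=> [y Iy <-]; exists (b * y); [exists y | rewrite mulrA].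
Qed.

Lemma scale1 I : scale 1 I = I.
Proof.
apply/seteqP; split=> z; first by move=> [y Iy <-]; rewrite mul1r.
by move=> Iz; exists z; rewrite ?mul1r.
Qed.

Lemma principal_scale a I : a != 0 -> principal D (scale a I) -> principal D I.
Proof.
move=> a0 [g E]; exists (a^-1 * g).
by rewrite -scale_scale -E scale_scale mulVf ?scale1.
Qed.

Lemma fractional_principal_or_scale b I :
    b != 0 -> ideal D (scale b I) -> ~ principal D I ->
  exists2 a, a != 0 & I = scale a Q.
Proof.
move=> b0 /two_classes[/(principal_scale b0) //|[d Dd E]] nI.
have IE : I = scale (b^-1 * d) Q.
  by rewrite -scale_scale -E scale_scale mulVf ?scale1.
exists (b^-1 * d) => //; apply: contra_not_neq nI => a0; exists 0.
rewrite IE a0; apply/seteqP; split=> z [y _ <-].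
  by exists 0; rewrite ?mul0r.
by exists 0; rewrite ?mul0r //; case: Qid.
Qed.

Lemma span2_module a u v z : D a -> span2 D u v z -> span2 D u v (a * z).
Proof.
move=> Da [p [q [Dp Dq ->]]]; exists (a * p), (a * q); split; try exact: DM.
by ring.
Qed.

(** * Overrings in the nonprincipal class *)

Section NonprincipalOverring.
Variables (u v a : K) (T : set K).
Hypothesis TE : T = span2 D u v.
Hypothesis TQ : T = scale a Q.
Hypothesis a0 : a != 0.
Hypothesis T1 : T 1.
Hypothesis TM : forall x y, T x -> T y -> T (x * y).
Hypothesis Tnp : ~ principal D T.

(** Since [T] is a ring in the class of [Q], it acts on [Q]. So [e Q] is again
    a nonprincipal ideal of [D], which makes it [d Q] with [d] in [D] and not
    just in [K]: this integrality of [d] is what the argument rests on. Then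
    [e T = d T]. *)
Lemma element_associate e :
  T e -> e != 0 -> exists d, [/\ D d, d != 0, T (e / d) & T (d / e)].
Proof.
move=> Te e0.
have eQ y : Q y -> Q (e * y).
  move=> Qy; have : T (e * (a * y)) by apply: TM => //; rewrite TQ; exists y.
  by rewrite TQ => -[y' Qy']; rewrite [RHS]mulrCA => /(mulfI a0) <-.
have eQid : ideal D (scale e Q).
  case: Qid => QD Q0 QDD QM; split.
  - by move=> _ [y Qy <-]; apply/QD/eQ.
  - by exists 0; rewrite ?mulr0.
  - move=> _ _ [y Qy <-] [z Qz <-].
    by exists (y + z); [apply: QDD | rewrite mulrDr].
  - by move=> r _ Dr [y Qy <-]; exists (r * y); [apply: QM | rewrite mulrCA].
case: (two_classes eQid) => [/(principal_scale e0) [g Qg]|[d Dd eQd]].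
  by case: Tnp; exists (a * g); rewrite TQ Qg scale_scale.
have eT : scale e T = scale d T.
  by rewrite TQ !scale_scale ![_ * a]mulrC -!scale_scale eQd.
have [t Tt te] : scale d T e by rewrite -eT; exists 1; rewrite ?mulr1.
have [s Ts sd] : scale e T d by rewrite eT; exists 1; rewrite ?mulr1.
have d0 : d != 0 by apply: contra_neq e0 => d0; rewrite -te d0 mul0r.
exists d; split=> //.
  by rewrite -te [d * t]mulrC mulfK.
by rewrite -sd [e * s]mulrC mulfK.
Qed.

Let TD x y : T x -> T y -> T (x + y).
Proof.
rewrite TE => -[p [q [Dp Dq ->]]] [r [s [Dr Ds ->]]].
by exists (p + r), (q + s); split; [exact: DD | exact: DD | ring].
Qed.

Let D_T x : D x -> T x.
Proof.
by move=> Dx; rewrite -[x]mulr1 TE; apply: span2_module => //; rewrite -TE.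
Qed.

Lemma one_notin_extended_maximal : ~ span2 M u v 1.
Proof.
move=> MT1; apply: M1.
have Tu : T u by rewrite TE; exists 1, 0; split=> //; ring.
have Tv : T v by rewrite TE; exists 0, 1; split=> //; ring.
have MT t : T t -> span2 M u v t.
  move=> Tt; case: MT1 => m [n [Mm Mn mn1]].
  have := TM Tu Tt; have := TM Tv Tt; rewrite TE.
  move=> [p [q [Dp Dq pq]]] [r [s [Dr Ds rs]]].
  exists (r * m + p * n), (s * m + q * n).
  split; try by apply: M_add; apply: M_mul.
  rewrite -[LHS]mul1r mn1 mulrDl -!mulrA pq rs; ring.
have uv0 : (u != 0) || (v != 0).
  apply: contraPT MT1; rewrite negb_or !negbK => /andP[/eqP -> /eqP ->].
  move=> [m [n [_ _]]]; rewrite !mulr0 addr0 => /eqP.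
  by rewrite (negbTE (oner_neq0 K)).
apply: (span2_fixed M_add M_opp _ uv0 (MT _ Tu) (MT _ Tv)).
by move=> x y Mx My; apply: M_mul => //; apply: MD.
Qed.

(** Up to units of [T] its elements lie in [D], so two non-units lie in
    [M T], and their sum cannot be [1]. *)
Lemma nonprincipal_overring_local e f :
  T e -> T f -> e + f = 1 -> unit_in T e \/ unit_in T f.
Proof.
move=> Te Tf ef1.
have [e0|e0] := eqVneq e 0.
  by right; move: ef1; rewrite e0 add0r => ->; split; rewrite ?oner_neq0 ?invr1.
have [f0|f0] := eqVneq f 0.
  by left; move: ef1; rewrite f0 addr0 => ->; split; rewrite ?oner_neq0 ?invr1.
have [d [Dd d0 Ted Tde]] := element_associate Te e0.
have [c [Dc c0 Tfc Tcf]] := element_associate Tf f0.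
have unit_of x y : D y -> x != 0 -> T (y / x) -> ~ M y -> unit_in T x.
  move=> Dy x0 Tyx nMy; have [y0 Dy'] := Munit Dy nMy; split=> //.
  have -> : x^-1 = y^-1 * (y / x) by rewrite mulKf.
  exact: TM (D_T Dy') Tyx.
have [Md|nMd] := EM (M d); last by left; apply: unit_of nMd.
have [Mc|nMc] := EM (M c); last by right; apply: unit_of nMc.
case: one_notin_extended_maximal.
move: Ted Tfc; rewrite TE => -[p [q [Dp Dq pq]]] [r [s [Dr Ds rs]]].
exists (p * d + r * c), (q * d + s * c).
split; try by apply: M_add; apply: M_mul.
rewrite -ef1 -[e](mulfVK d0) -[f](mulfVK c0) pq rs; ring.
Qed.

End NonprincipalOverring.

(** * The ring attached to an element of an overring *)

Definition span3 (x : K) : set K :=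
  [set z | exists p q r, [/\ D p, D q, D r & z = p + q * x + r * x ^+ 2]].

(** A principal finitely generated module over a quasi-local domain is generated
    by one of the given generators. *)
Lemma principal_span3 x : principal D (span3 x) -> D x \/ unit_in D x.
Proof.
move=> [g E].
have I1 : span3 x 1 by exists 1, 0, 0; split=> //; ring.
have Ix : span3 x x by exists 0, 1, 0; split=> //; ring.
have Ixx : span3 x (x ^+ 2) by exists 0, 0, 1; split=> //; ring.
have Ig : span3 x g by rewrite E; exists 1; rewrite ?mulr1.
move: I1 Ix Ixx Ig; rewrite E => -[r Dr r1] [s Ds sx] [t Dt tx]; rewrite -E.
move=> [p [q [w [Dp Dq Dw gE]]]].
have g0 : g != 0 by apply: contra_eq_neq r1 => ->; rewrite mul0r eq_sym oner_neq0.
have [->|x0] := eqVneq x 0; first by left.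
have pqw1 : p * r + q * s + w * t = 1.
  apply: (mulfI g0); rewrite mulr1 [RHS]gE -tx -sx -[p in RHS]mulr1 -r1; ring.
have [Mr|nMr] := EM (M r); last first.
  left; have [r0 Dr'] := Munit Dr nMr; have -> : x = s * r^-1; last exact: DM.
  apply: (mulIf r0); rewrite mulfVK //; apply: (mulfI g0).
  by rewrite sx mulrCA r1 mulr1.
right; split=> //.
have [Ms|nMs] := EM (M s); last first.
  have [s0 Ds'] := Munit Ds nMs; have -> : x^-1 = r * s^-1; last exact: DM.
  apply: (mulIf s0); rewrite mulfVK //; apply: (mulfI x0).
  by rewrite mulVKf // -sx mulrAC r1 mul1r.
have [Mt|nMt] := EM (M t).
  by case: M1; rewrite -pqw1; apply: M_add; [apply: M_add|]; apply: M_mul.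
have [t0 Dt'] := Munit Dt nMt; have -> : x^-1 = s * t^-1; last exact: DM.
apply: (mulIf t0); rewrite mulfVK //; apply: (mulfI g0); apply: (mulfI x0).
by rewrite sx mulrCA mulVKf.
Qed.

Lemma principal_span2 x : principal D (span2 D 1 x) -> principal D (span3 x).
Proof.
move=> [g E].
have I1 : span2 D 1 x 1 by exists 1, 0; split=> //; ring.
have Ix : span2 D 1 x x by exists 0, 1; split=> //; ring.
have Ig : span2 D 1 x g by rewrite E; exists 1; rewrite ?mulr1.
move: I1 Ix Ig; rewrite E => -[r Dr r1] [s Ds sx]; rewrite -E.
move=> [p [q [Dp Dq gE]]].
exists (g ^+ 2); apply/seteqP; split=> z.
  move=> [a [b [c [Da Db Dc ->]]]].
  exists (a * r ^+ 2 + b * (r * s) + c * s ^+ 2).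
    by do ![apply: DD | apply: DM].
  transitivity (a * (g * r) ^+ 2 + b * ((g * r) * (g * s)) + c * (g * s) ^+ 2).
    by ring.
  by rewrite r1 sx; ring.
move=> [d Dd <-].
exists (d * (p * p)), (d * (p * q + p * q)), (d * (q * q)).
by split; [do ![apply: DD | apply: DM] .. | rewrite gE; ring].
Qed.

Lemma unit_in_overring A x : D `<=` A -> unit_in D x -> unit_in A x.
Proof. by move=> DA [x0 Dx]; split=> //; apply: DA. Qed.

(** The ring [T] lies in [I = D + D x], hence in [A], because it multiplies [I]
    into [I] and [1] is in [I]; so units of [T] are units of [A]. Its generators
    [1 / c] and [x / c] cannot both be non-units. If [1 / c] is a unit, then [x]
    itself is in [T] and quasi-locality of [T] applies to [x] and [1 - x]; if
    [x / c] is a unit, then [1 / x] is in [T]. *)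
Lemma overring_unit_or A x :
    (forall y : K, exists a b, [/\ D a, D b, b != 0 & y = a / b]) ->
  subring A -> D `<=` A -> A x -> unit_in A x \/ unit_in A (1 - x).
Proof.
move=> quot Aring DA Ax.
pose I := span2 D 1 x.
have [pI2|npI2] := EM (principal D (span3 x)).
  case: (principal_span3 pI2) => [Dx|/(unit_in_overring DA)]; last by left.
  have [Mx|nMx] := EM (M x); last by left; apply/(unit_in_overring DA)/Munit.
  right; apply/(unit_in_overring DA)/Munit.
    by rewrite addrC; apply/DD/D1/DN.
  by move=> Mx1; apply: M1; rewrite -(subrK x 1); apply: M_add.
have npI : ~ principal D I by move=> /principal_span2.
have [n [b [Dn Db b0 xE]]] := quot x.
have bx : b * x = n by rewrite xE mulrC mulfVK.
have I_id : ideal D (scale b I).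
  split.
  - move=> _ [_ [p [q [Dp Dq ->]]] <-].
    have -> : b * (p * 1 + q * x) = p * b + q * (b * x) by ring.
    by rewrite bx; apply: DD; apply: DM.
  - by exists 0; rewrite ?mulr0 //; exists 0, 0; split=> //; ring.
  - move=> _ _ [_ [p [q [Dp Dq ->]]] <-] [_ [r [s [Dr Ds ->]]] <-].
    exists ((p + r) * 1 + (q + s) * x); last by ring.
    by exists (p + r), (q + s); split=> //; apply: DD.
  - move=> d _ Dd [y Iy <-]; exists (d * y); last by ring.
    exact: span2_module.
have I2_id : ideal D (scale (b ^+ 2) (span3 x)).
  split.
  - move=> _ [_ [p [q [r [Dp Dq Dr ->]]]] <-].
    have -> : b ^+ 2 * (p + q * x + r * x ^+ 2) =
        p * (b * b) + q * (b * (b * x)) + r * ((b * x) * (b * x)) by ring.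
    by rewrite bx; do ![apply: DD | apply: DM].
  - by exists 0; rewrite ?mulr0 //; exists 0, 0, 0; split=> //; ring.
  - move=> _ _ [_ [p [q [r [Dp Dq Dr ->]]]] <-] [_ [s [t [w [Ds Dt Dw ->]]]] <-].
    exists ((p + s) + (q + t) * x + (r + w) * x ^+ 2); last by ring.
    by exists (p + s), (q + t), (r + w); split=> //; apply: DD.
  - move=> d _ Dd [_ [p [q [r [Dp Dq Dr ->]]]] <-].
    exists (d * (p + q * x + r * x ^+ 2)); last by ring.
    exists (d * p), (d * q), (d * r); split; [exact: DM .. | by ring].
have [a a0 IQ] := fractional_principal_or_scale b0 I_id npI.
have [a' a'0 I2Q] := fractional_principal_or_scale (expf_neq0 2 b0) I2_id npI2.
pose c := a' / a.
have c0 : c != 0 by rewrite mulf_neq0 ?invr_eq0.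
have I2E : span3 x = scale c I by rewrite I2Q IQ scale_scale mulfVK.
have I_A : I `<=` A.
  move=> _ [p [q [Dp Dq ->]]]; rewrite mulr1.
  by apply: subringD; [|apply: DA|apply: subringM => //; apply: DA].
have II y z : I y -> I z -> scale c I (y * z).
  move=> [p [q [Dp Dq ->]]] [r [s [Dr Ds ->]]]; rewrite -I2E.
  exists (p * r), (p * s + q * r), (q * s).
  by split; [do ![apply: DD | apply: DM] .. | ring].
have I1 : I 1 by exists 1, 0; split=> //; ring.
have Ix : I x by exists 0, 1; split=> //; ring.
pose u := c^-1; pose v := x / c.
pose T := span2 D u v.
have TI z : T z <-> I (c * z).
  split=> -[p [q [Dp Dq E]]]; exists p, q; split=> //.
    by rewrite E /u /v; field.
  by apply: (mulfI c0); rewrite E /u /v; field.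
have TQ : T = scale (c^-1 * a) Q.
  rewrite -scale_scale -IQ; apply/seteqP; split=> z.
    by move=> /TI Icz; exists (c * z); rewrite ?mulKf.
  by move=> [y Iy <-]; apply/TI; rewrite mulVKf.
have TM y z : T y -> T z -> T (y * z).
  move=> /TI Iy /TI Iz; apply/TI.
  have [w Iw E] := II _ _ Iy Iz.
  have -> // : c * (y * z) = w by apply: (mulfI c0); rewrite E; ring.
have T_I : T `<=` I.
  move=> t /TI It; have [w Iw E] := II _ _ It I1.
  by have <- : w = t by apply: (mulfI c0); rewrite E mulr1.
have TD y z : T y -> T z -> T (y + z).
  move=> [p [q [Dp Dq ->]]] [r [s [Dr Ds ->]]].
  by exists (p + r), (q + s); split; [exact: DD | exact: DD | ring].
have TN y : T y -> T (- y).
  move=> [p [q [Dp Dq ->]]].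
  by exists (- p), (- q); split; [exact: DN | exact: DN | ring].
(* The inclusion of [c I] in [I^2] provides the coefficients in [T]. *)
have TT z : I z -> span2 T u v (z / c).
  move=> Iz; have : span3 x (c * z) by rewrite I2E; exists z.
  move=> [p [q [r [Dp Dq Dr E]]]]; exists (p / c), ((q + r * x) / c); split.
  - by exists p, 0; split=> //; rewrite /u; ring.
  - by exists q, r; split=> //; rewrite /u /v; ring.
  - apply: (mulfI c0); apply: (mulfI c0); rewrite /u /v.
    transitivity (c * z); first by field.
    by rewrite E; field.
have T1 : T 1.
  apply: (span2_fixed TD TN TM _ _ (TT _ Ix)); first by rewrite invr_eq0 c0.
  by have := TT _ I1; rewrite mul1r.
have Ic : I c by have := (TI 1).1 T1; rewrite mulr1.
have DT d : D d -> T d.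
  by move=> Dd; rewrite -[d]mulr1; apply: span2_module.
have npT : ~ principal D T.
  rewrite TQ -scale_scale -IQ.
  by move=> /(principal_scale _) npT; apply/npI/npT; rewrite invr_eq0.
have ca0 : c^-1 * a != 0 by rewrite mulf_neq0 ?invr_eq0.
have loc := nonprincipal_overring_local (erefl T) TQ ca0 T1 TM npT.
have T_A y : unit_in T y -> unit_in A y.
  by move=> [y0 Ty]; split=> //; apply/I_A/T_I.
have Tu : T u by apply/TI; rewrite /u divff.
have Tv : T v by apply/TI; rewrite /v mulrC mulfVK.
case: (T1) => p [q [Dp Dq pq1]].
have := loc (p * u) (q * v) (TM _ _ (DT _ Dp) Tu) (TM _ _ (DT _ Dq) Tv) (esym pq1).
case=> -[e0 Te]; move: e0 Te; rewrite mulf_eq0 negb_or => /andP[p0 e0] Te.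
  have Tc : T c.
    have -> : c = p * (p * u)^-1 by rewrite invfM /u invrK mulVKf.
    by apply: TM => //; apply: DT.
  have Tx : T x by rewrite -[x](mulfVK c0); apply: TM.
  have T1x : T (1 - x) by apply: TD => //; apply: TN.
  have sum1 : x + (1 - x) = 1 by rewrite addrC subrK.
  by case: (loc _ _ Tx T1x sum1) => /T_A; [left|right].
have x0 : x != 0 by apply: contra_neq e0 => x0; rewrite /v x0 mul0r.
left; apply: T_A; split=> //.
have -> : x^-1 = u * (q * (q * v)^-1).
  by rewrite invfM mulVKf // /v /u; field; rewrite x0 c0.
exact: (TM _ _ Tu (TM _ _ (DT _ Dq) Te)).
Qed.

End TwoClasses.
End QuasiLocal.
End Subrings.

Theorem lemma3 (K : fieldType) (D : set K) :
  subring D -> quotient_field_of D -> quasi_local D -> GMPD_domain D ->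
  overrings D = ql_overrings D.
Proof.
move=> Dring quot [M [Mmax Muniq]] [_ mpd].
have [Mid nM _] := Mmax.
have Munit s : D s -> ~ M s -> unit_in D s.
  move=> Ds nMs; apply: contrapT => nu; apply: nMs.
  have [N Nmax Ns] := nonunit_in_maximal_ideal Dring Ds nu.
  by rewrite (Muniq _ Nmax).
have M1 : ~ M 1.
  move=> M1; apply: (proper_ideal_nonunit Dring Mid nM M1).
  by split; rewrite ?oner_neq0 ?invr1 //; apply: subring1.
have [Q [[Qid _ _] _] classes] := mpd _ Mmax.
rewrite (local_localization Dring M1 Munit) in Qid classes.
have two := principal_or_scale_MNI Dring Mid M1 Munit Qid classes.
apply/seteqP; split=> A; last by case.
move=> AD; split=> //; case: AD => Aring DA.
apply: (quasi_local_unit_or Aring) => x Ax.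
exact: (overring_unit_or Dring Mid M1 Munit Qid two quot Aring DA Ax).
Qed.
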